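(* Let $\phi$ be an odd set composition of $[n]$ and $\psi$ a set composition with $\psi\le\phi$. Then $$\sum_{\chi\in\mathscr D_\phi^\psi}2^{\ell(\psi\wedge\chi)-\ell(\chi)}\mu_{\ell(\chi)}=2^{\ell(\psi)-1}.$$
   Context: $[n]=\{1,\dots,n\}$. A set composition $\phi=\phi_1|\cdots|\phi_{\ell(\phi)}$ of $[n]$ is a sequence of pairwise disjoint nonempty sets with union $[n]$; it is odd if every block has odd size. For set compositions, $\psi\le\phi$ means each block of $\psi$ is a union of consecutive blocks of $\phi$. $\psi\wedge\chi$ is the set composition obtained from $\psi_1\cap\chi_1,\psi_1\cap\chi_2,\dots,\psi_1\cap\chi_{\ell(\chi)},\psi_2\cap\chi_1,\dots,\psi_{\ell(\psi)}\cap\chi_{\ell(\chi)}$ by deleting empty sets. $\mathscr C_\phi^\psi=\{\phi_{\tau(1)}|\cdots|\phi_{\tau(\ell(\phi))}:\tau\in\mathfrak S_{\ell(\phi)},\ \psi\wedge(\phi_{\tau(1)}|\cdots|\phi_{\tau(\ell(\phi))})=\phi\}$, and $\mathscr D_\phi^\psi=\{\chi:\chi\text{ an odd set composition of }[n],\ \chi\le\xi\text{ for some }\xi\in\mathscr C_\phi^\psi\}$. For a positive integer $\ell$, consider the poset of odd compositions of $\ell$ (sequences of odd positive integers summing to $\ell$), ordered by $\beta\le\alpha$ if each part of $\beta$ is a sum of consecutive parts of $\alpha$, with Möbius function $\mu$; set $\mu_\ell=\sum_{\beta}\mu(\beta,(1,1,\dots,1))$, summed over all odd compositions $\beta$ of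 $\ell$. *)

(* Defs.v *)
From HB Require Import structures.
From mathcomp Require Import all_boot all_order all_fingroup all_algebra.
Set Implicit Arguments.
Unset Strict Implicit.
Unset Printing Implicit Defensive.
Import Order.TTheory GRing.Theory Num.Theory.
Local Open Scope nat_scope.

Definition is_comp (l : nat) (s : seq nat) : bool :=
  all (leq 1) s && (sumn s == l).

Record composition (l : nat) := Composition {
  comp_val :> seq nat;
  compP : is_comp l comp_val }.

HB.instance Definition _ l := [isSub for @comp_val l].
HB.instance Definition _ l := [Countable of composition l by <:].

Lemma size_comp l (s : composition l) : size s <= l.
Proof.
case: s => s /= /andP[+ /eqP <-].
by elim: s => //= x s IH /andP[x1 /IH]; rewrite -add1n; apply: leq_add.
Qed.

Lemma comp_part l (s : composition l) x : x \in (s : seq nat) -> x < l.+1.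
Proof.
case: s => s /= /andP[_ /eqP <-]; rewrite ltnS.
elim: s => //= y s IH; rewrite inE => /orP[/eqP->|/IH]; first exact: leq_addr.
by move=> h; apply: leq_trans h (leq_addl _ _).
Qed.

Lemma comp_code_size l (s : composition l) :
  size [seq @inord l x | x <- s] <= l.
Proof. by rewrite size_map size_comp. Qed.

Definition comp_code l (s : composition l) : {bseq l of 'I_l.+1} :=
  Bseq (comp_code_size s).

Definition comp_decode l (b : {bseq l of 'I_l.+1}) : option (composition l) :=
  insub [seq nat_of_ord i | i <- b].

Lemma comp_codeK l : pcancel (@comp_code l) (@comp_decode l).
Proof.
move=> s; rewrite /comp_decode /= -map_comp.
rewrite (_ : map _ _ = val s) ?valK // -[RHS]map_id.
by apply/eq_in_map => x xs /=; rewrite inordK // (comp_part xs).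
Qed.

HB.instance Definition _ l := isFinite.Build (composition l)
  (pcan_enumP (@comp_codeK l)).

(* [coarser op s t] : [s] is obtained from [t] by cutting [t] into nonempty
   runs of consecutive entries, of lengths given by a composition [sh] of
   [size t], and merging each run with [op], keeping the order of the runs. *)
Definition coarser (T : eqType) (op : seq T -> T) (s t : seq T) : bool :=
  [exists sh : composition (size t), s == [seq op b | b <- reshape sh t]].

Section Coarser.
Variables (T : eqType) (op : seq T -> T).
Hypothesis op1 : forall x, op [:: x] = x.
Hypothesis op_flatten : forall bs, op (map op bs) = op (flatten bs).

Lemma coarserP s t :
  reflect (exists r : seq (seq T),
             [/\ all (fun b => b != [::]) r, flatten r = t & map op r = s])
          (coarser op s t).
Proof.
apply: (iffP existsP) => [[[sh /=]] | [r [r0 <- <-]]].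
  case/andP=> sh0 /eqP shE /eqP->; exists (reshape sh t).
  split=> //; last by rewrite reshapeKr ?shE.
  have: all (leq 1) (shape (reshape sh t)) by rewrite reshapeKl ?shE.
  by rewrite /shape all_map; apply: sub_all => -[].
have shP : is_comp (size (flatten r)) (shape r).
  rewrite /is_comp size_flatten eqxx andbT /shape all_map.
  by apply: sub_all r0 => -[].
by exists (Composition shP); rewrite /= flattenK.
Qed.

Lemma coarser_refl : reflexive (coarser op).
Proof.
move=> s; apply/coarserP; exists [seq [:: x] | x <- s]; split.
- by rewrite all_map; apply/allP.
- exact: flatten_seq1.
- by rewrite -map_comp -[RHS]map_id; apply: eq_map.
Qed.

Lemma coarser_size s t : coarser op s t -> size s <= size t ?= iff (s == t).
Proof.
case/coarserP=> r [r0 <- <-].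
have: size r <= size (flatten r) ?= iff (map op r == flatten r).
  elim: r r0 => [|b r IH] //= /andP[b0 /IH {}IH].
  case: b b0 => // x [|y b] _; first by rewrite /= op1 eqseq_cons eqxx.
  have lt: size (op [:: x, y & b] :: map op r) < size (flatten ([:: x, y & b] :: r)).
    rewrite /= size_map size_cat !ltnS.
    by apply: leq_trans IH.1 (leq_addl _ _).
  rewrite /= size_map in lt; split; first exact: ltnW.
  rewrite (ltn_eqF lt); apply/esym/negbTE/eqP => /(congr1 size).
  by move=> E; rewrite /= size_map in E; move: lt; rewrite /= E ltnn.
by rewrite size_map.
Qed.

Lemma coarser_anti : antisymmetric (coarser op).
Proof.
move=> s t /andP[/coarser_size st /coarser_size ts]; apply/eqP.
by rewrite -st.2 eqn_leq st.1 ts.1.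
Qed.

Lemma coarser_trans : transitive (coarser op).
Proof.
move=> t s u /coarserP[r [r0 rt <-]] /coarserP[q [q0 <- qt]].
apply/coarserP; pose R := reshape (shape r) q.
have sz : sumn (shape r) = size q by rewrite -size_flatten rt -qt size_map.
have Rq : flatten R = q by rewrite /R reshapeKr ?sz.
have Rr : map (map op) R = r by rewrite /R map_reshape qt -rt flattenK.
exists (map flatten R); split.
- rewrite all_map; apply/allP => c cR /=.
  have: map op c \in r by rewrite -Rr; apply: map_f.
  move/(allP r0); case: c cR => // b c cR _ /=.
  have: b \in q by rewrite -Rq; apply/flattenP; exists (b :: c); rewrite ?mem_head.
  by move/(allP q0); case: b {cR}.
- by rewrite -Rq; elim: (R) => //= c R' ->; rewrite flatten_cat.
- by rewrite -Rr -!map_comp; apply: eq_map => c /=; rewrite op_flatten.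
Qed.

End Coarser.

Lemma sumn1 x : sumn [:: x] = x.
Proof. exact: addn0. Qed.

Lemma sumn_map_sumn bs : sumn (map sumn bs) = sumn (flatten bs).
Proof. by rewrite sumn_flatten. Qed.

Fact comp_display : Order.disp_t. Proof. exact: Order.Disp tt tt. Qed.

Definition comp_le l (b a : composition l) : bool := coarser sumn b a.

Lemma comp_le_refl l : reflexive (@comp_le l).
Proof. by move=> a; apply: coarser_refl sumn1 a. Qed.
Lemma comp_le_anti l : antisymmetric (@comp_le l).
Proof. by move=> a b ab; apply/val_inj/(coarser_anti sumn1). Qed.
Lemma comp_le_trans l : transitive (@comp_le l).
Proof. by move=> b a c; apply: coarser_trans sumn_map_sumn b a c. Qed.

HB.instance Definition _ l := Order.Le_isPOrder.Build comp_display
  (composition l) (@comp_le_refl l) (@comp_le_anti l) (@comp_le_trans l).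

Record oddcomp (l : nat) := OddComp {
  oddcomp_val :> composition l;
  oddcompP : all odd oddcomp_val }.

HB.instance Definition _ l := [isSub for @oddcomp_val l].
HB.instance Definition _ l := [Finite of oddcomp l by <:].
HB.instance Definition _ l :=
  [SubChoice_isSubPOrder of oddcomp l by <: with comp_display].

Lemma comp_ones_subproof l : is_comp l (nseq l 1).
Proof. by rewrite /is_comp sumn_nseq mul1n eqxx all_nseq orbT. Qed.

Lemma oddcomp_ones_subproof l : all odd (Composition (comp_ones_subproof l)).
Proof. by rewrite /= all_nseq orbT. Qed.

Definition oddcomp_ones l : oddcomp l := OddComp (oddcomp_ones_subproof l).

Section Moebius.
Context {d : Order.disp_t} {T : finPOrderType d}.
Implicit Types x y z : T.
Local Open Scope ring_scope.

Fixpoint moebius_rec (k : nat) (x y : T) : int :=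
  if x == y then 1
  else if k is k'.+1 then
    if (x < y)%O then - \sum_(z | (x <= z < y)%O) moebius_rec k' x z else 0
  else 0.

(* [#|T|] bounds the length of every chain, so the fuel never runs out: see
   [moebiusE]. *)
Definition moebius (x y : T) : int := moebius_rec #|T| x y.

Lemma moebius_recE k1 k2 x y :
    (#|[set z | (z < y)%O]| <= k1)%N -> (#|[set z | (z < y)%O]| <= k2)%N ->
  moebius_rec k1 x y = moebius_rec k2 x y.
Proof.
have lt0 y' : (#|[set z | (z < y')%O]| <= 0)%N -> (x < y')%O = false.
  rewrite leqn0 cards_eq0 => /eqP E.
  by have := in_set0 x; rewrite -E inE.
elim: k1 k2 y => [|k1 IH] [|k2] y //= h1 h2.
- by rewrite lt0.
- by rewrite lt0.
case: eqP => // _; case: ifP => // _; congr (- _).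
apply: eq_bigr => z /andP[_ zy].
have lt: (#|[set t | (t < z)%O]| < #|[set t | (t < y)%O]|)%N.
  apply: proper_card; apply/properP; split; last first.
    by exists z; rewrite !inE ?ltxx.
  by apply/subsetP => t; rewrite !inE => /lt_trans; apply.
by apply: IH; rewrite -ltnS; apply: leq_trans lt _.
Qed.

Lemma moebiusE x y :
  moebius x y =
    if x == y then 1
    else if (x < y)%O then - \sum_(z | (x <= z < y)%O) moebius x z else 0.
Proof.
rewrite /moebius.
rewrite (@moebius_recE #|T| #|T|.+1) ?(leqW (max_card _)) ?max_card //=.
Qed.

End Moebius.

(* For [l = 0], which is excluded in the mathematics, this is 1. *)
Definition mu_odd (l : nat) : int :=
  (\sum_(b : oddcomp l) moebius b (oddcomp_ones l))%R.

(* ['I_n] plays the role of [{1, ..., n}]. *)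
Definition is_setcomp n (s : seq {set 'I_n}) : bool :=
  [&& all (fun B => B != set0) s,
      pairwise (fun A B : {set 'I_n} => [disjoint A & B]) s
    & \bigcup_(B <- s) B == [set: 'I_n]].

Record setcomp (n : nat) := SetComp {
  blocks :> seq {set 'I_n};
  setcompP : is_setcomp blocks }.

HB.instance Definition _ n := [isSub for @blocks n].
HB.instance Definition _ n := [Countable of setcomp n by <:].

Lemma disjoint_bigcup_seq n (A : {set 'I_n}) (s : seq {set 'I_n}) :
  all (fun B : {set 'I_n} => [disjoint A & B]) s =
  [disjoint A & \bigcup_(B <- s) B].
Proof.
elim: s => [|B s IH] /=; first by rewrite big_nil -setI_eq0 setI0 eqxx.
by rewrite big_cons IH -!setI_eq0 setIUr setU_eq0.
Qed.

Lemma size_setcomp n (s : setcomp n) : size s <= n.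
Proof.
case: s => s /= /and3P[s0 sd _].
apply: (@leq_trans #|\bigcup_(B <- s) B|); last first.
  by rewrite -[X in _ <= X]card_ord max_card.
elim: s s0 sd => //= B s IH /andP[B0 s0] /andP[Bs sd].
rewrite disjoint_bigcup_seq -setI_eq0 in Bs.
rewrite big_cons cardsU (eqP Bs) cards0 subn0 -add1n leq_add ?IH //.
by rewrite card_gt0.
Qed.

Lemma bigcup_seqE n (s : seq {set 'I_n}) x :
  (x \in \bigcup_(B <- s) B) = has (fun B : {set 'I_n} => x \in B) s.
Proof.
by elim: s => [|B s IH]; rewrite ?big_nil ?big_cons ?inE //= IH.
Qed.

Definition setcomp_code n (s : setcomp n) : {bseq n of {set 'I_n}} :=
  Bseq (size_setcomp s).

Definition setcomp_decode n (b : {bseq n of {set 'I_n}}) : option (setcomp n) :=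
  insub (b : seq {set 'I_n}).

Lemma setcomp_codeK n : pcancel (@setcomp_code n) (@setcomp_decode n).
Proof. by move=> s; rewrite /setcomp_decode /= valK. Qed.

HB.instance Definition _ n := isFinite.Build (setcomp n)
  (pcan_enumP (@setcomp_codeK n)).

Definition setcomp_odd n (s : setcomp n) : bool :=
  all (fun B : {set 'I_n} => odd #|B|) s.

Definition union_seq n (s : seq {set 'I_n}) : {set 'I_n} := \bigcup_(B <- s) B.

Lemma union_seq1 n (B : {set 'I_n}) : union_seq [:: B] = B.
Proof. exact: big_seq1. Qed.

Lemma union_seq_flatten n (bs : seq (seq {set 'I_n})) :
  union_seq (map (@union_seq n) bs) = union_seq (flatten bs).
Proof. by rewrite /union_seq big_map big_flatten. Qed.

Fact setcomp_display : Order.disp_t. Proof. exact: Order.Disp tt tt. Qed.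

Definition setcomp_le n (psi phi : setcomp n) : bool :=
  coarser (@union_seq n) psi phi.

Lemma setcomp_le_refl n : reflexive (@setcomp_le n).
Proof. by move=> a; apply: coarser_refl (@union_seq1 n) a. Qed.
Lemma setcomp_le_anti n : antisymmetric (@setcomp_le n).
Proof. by move=> a b ab; apply/val_inj/(coarser_anti (@union_seq1 n)). Qed.
Lemma setcomp_le_trans n : transitive (@setcomp_le n).
Proof. by move=> b a c; apply: coarser_trans (@union_seq_flatten n) b a c. Qed.

HB.instance Definition _ n := Order.Le_isPOrder.Build setcomp_display
  (setcomp n) (@setcomp_le_refl n) (@setcomp_le_anti n) (@setcomp_le_trans n).

Definition meet_seq n (s t : seq {set 'I_n}) : seq {set 'I_n} :=
  [seq B <- [seq P :&: Q | P <- s, Q <- t] | B != set0].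

Lemma meet_seq_subproof n (s t : setcomp n) : is_setcomp (meet_seq s t).
Proof.
case: s t => [s /= /and3P[_ sd /eqP sT]] [t /= /and3P[_ td /eqP tT]].
apply/and3P; split; first exact: filter_all.
  apply: pairwise_filter.
  elim: s sd {sT} => //= P s IH /andP[Ps /IH {}IH].
  rewrite pairwise_cat IH andbT; apply/andP; split.
    apply/allrelP => _ _ /mapP[Q _ ->] /allpairsP[[P' Q'] /= [P's _ ->]].
    apply: disjointWl (subsetIl _ _) _; apply: disjointWr (subsetIl _ _) _.
    exact: (allP Ps).
  rewrite pairwise_map; apply: sub_pairwise td => Q Q' /= dQ.
  by apply: disjointWl (subsetIr _ _) _; apply: disjointWr (subsetIr _ _) _.
apply/eqP/setP => x; rewrite inE.
have [P Ps xP]: exists2 P, P \in s & x \in P.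
  by have := in_setT x; rewrite -sT bigcup_seqE => /hasP.
have [Q Qt xQ]: exists2 Q, Q \in t & x \in Q.
  by have := in_setT x; rewrite -tT bigcup_seqE => /hasP.
have xPQ : x \in P :&: Q by rewrite inE xP.
rewrite bigcup_seqE; apply/hasP; exists (P :&: Q) => //.
rewrite mem_filter; apply/andP; split; first by apply/set0Pn; exists x.
by apply/allpairsP; exists (P, Q).
Qed.

Definition setcomp_meet n (psi chi : setcomp n) : setcomp n :=
  SetComp (meet_seq_subproof psi chi).

Definition permute_seq n (s : seq {set 'I_n}) (tau : 'S_(size s)) :=
  [seq nth set0 s (tau i) | i : 'I_(size s)].

Lemma permute_seq_perm n (s : seq {set 'I_n}) (tau : 'S_(size s)) :
  perm_eq (permute_seq tau) s.
Proof.
rewrite /permute_seq -[X in perm_eq _ X](mkseq_nth set0) /mkseq -val_enum_ord.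
rewrite -map_comp /image_mem.
rewrite (map_comp (fun i : 'I__ => nth set0 s i) tau); apply: perm_map.
apply: uniq_perm; rewrite ?enum_uniq ?(map_inj_uniq perm_inj) ?enum_uniq //.
move=> i; rewrite mem_enum inE; apply/mapP; exists (tau^-1 i)%g.
  by rewrite mem_enum.
by rewrite permKV.
Qed.

Lemma permute_subproof n (phi : setcomp n) (tau : 'S_(size phi)) :
  is_setcomp (permute_seq tau).
Proof.
have pq := permute_seq_perm tau.
have /and3P[p0 pd pT] := setcompP phi.
apply/and3P; split.
- by rewrite (perm_all _ pq).
- have sym: symmetric (fun A B : {set 'I_n} => [disjoint A & B]).
    by move=> A B; rewrite disjoint_sym.
  rewrite /permute_seq /image_mem pairwise_map.
  have inj := @perm_inj _ tau.
  have dis (i j : 'I_(size phi)) :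
      i != j -> [disjoint nth set0 phi i & nth set0 phi j].
    move=> ij; wlog lt: i j ij / i < j => [H|].
      case: (ltngtP i j) => [/H|/H|E]; first exact.
      - by rewrite disjoint_sym; apply; rewrite eq_sym.
      - by rewrite (val_inj E) eqxx in ij.
    by move/(pairwiseP set0): pd; apply; rewrite ?inE.
  have := enum_uniq 'I_(size phi); rewrite uniq_pairwise.
  by apply: sub_pairwise => i j /= ij; apply: dis; rewrite (inj_eq inj).
- by rewrite (perm_big _ pq).
Qed.

Definition setcomp_permute n (phi : setcomp n) (tau : 'S_(size phi)) :
  setcomp n := SetComp (permute_subproof tau).

Definition setcomp_C n (phi psi : setcomp n) : {set setcomp n} :=
  [set setcomp_permute tau | tau : 'S_(size phi)
     & setcomp_meet psi (setcomp_permute tau) == phi].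

Definition setcomp_D n (phi psi : setcomp n) : {set setcomp n} :=
  [set chi | setcomp_odd chi
     & [exists xi in setcomp_C phi psi, (chi <= xi)%O]].

(* Main.v *)
Require Import Defs.
From mathcomp Require Import all_boot all_order all_fingroup all_algebra.
From mathcomp Require Import ring zify.
Import Order.TTheory GRing.Theory Num.Theory.
Set Implicit Arguments.
Unset Strict Implicit.
Unset Printing Implicit Defensive.
Local Open Scope ring_scope.

(** The Möbius numbers are multiplicative over the parts of [b], with
    [mu(b, 1...1)] the product of the coefficients [c_(b_i)] of the compositional
    inverse [C] of [x / (1 - x^2)]; hence [\sum_l mu_l u^l = u + u C(u)]
    [= u + (sqrt (1 + 4 u^2) - 1) / 2].  An odd [chi] lies in [D] exactly when
    all unions of initial blocks of [chi] are lower sets for the preorder "same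
    block of [psi], and not later in [phi]".  In the incidence algebra of these
    lower sets let [G(S, T) = 2 ^ (number of blocks of psi meeting T \ S)].
    Changing the sign by the parity of [T \ S] turns [G] into its inverse, so the
    odd part of [G] is [(G - G^-1) / 2], and the sum over [D] is the entry at
    (empty set, whole set) of [\sum_l mu_l u^l] at [u = (G - G^-1) / 4].  Since
    [1 + 4 u^2 = ((G + G^-1) / 2)^2], this equals [(G - 1) / 2]. *)

(** * The generating function of the Möbius sums *)

(** Recursion over all smaller indices, with fuel [k]. At [b = 0] the sum is empty, so the truncated
    [b.-1] does no harm. *)
Fixpoint odd_inv_rec (k b : nat) : int :=
  if k is k'.+1 then
    (b == 1)%:R - \sum_(i < b) odd_inv_rec k' i * odd_inv_rec k' (b.-1 - i)
  else 0.

(** Coefficients of the power series [C] such that [C = X (1 - C ^ 2)]. *)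
Definition odd_inv (b : nat) : int := odd_inv_rec b.+1 b.

Arguments odd_inv : simpl never.

Lemma odd_inv_rec_fuel k k' b :
  (b < k)%N -> (b < k')%N -> odd_inv_rec k b = odd_inv_rec k' b.
Proof.
elim: k k' b => [|k IH] [|k'] b //= bk bk'; congr (_ - _).
by apply: eq_bigr => i _; congr (_ * _); apply: IH; have := ltn_ord i; lia.
Qed.

Lemma odd_invE b :
  odd_inv b = (b == 1)%:R - \sum_(i < b) odd_inv i * odd_inv (b.-1 - i).
Proof.
rewrite {1}/odd_inv /=; congr (_ - _).
by apply: eq_bigr => i _; congr (_ * _); apply: odd_inv_rec_fuel;
  have := ltn_ord i; lia.
Qed.

(** For even [b > 0] the two indices in each product add up to the odd number [b - 1], so one of
    them is even and smaller than [b]. *)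
Lemma odd_inv_even b : ~~ odd b -> odd_inv b = 0.
Proof.
elim/ltn_ind: b => b IH bE; rewrite odd_invE big1 => [|i _].
  by case: b bE {IH} => [|[]].
have ib := ltn_ord i.
case: (boolP (odd i)) => iO; last by rewrite IH ?mul0r.
by rewrite [X in _ * X]IH ?mulr0 //; lia.
Qed.

(** Coefficients of [1 + X + X C], which is [1 / (1 - C)]. *)
Definition odd_comp_sum (r : nat) : int :=
  (r == 0)%:R + (r == 1)%:R + odd_inv r.-1.

(** Coefficientwise form of [S = 1 + C S] for [S = 1 + X + X C]: in [C S = C + X C + X C ^ 2] the
    last term is [X - C]. *)
Lemma odd_comp_sum_rec b :
  odd_comp_sum b.+1 = \sum_(a < b.+2) odd_inv a * odd_comp_sum (b.+1 - a).
Proof.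
rewrite big_ord_recr /= subnn {3}/odd_comp_sum /=.
have -> : odd_inv 0 = 0 by rewrite odd_inv_even.
rewrite !addr0 mulr1.
under eq_bigr => a _.
  have -> : odd_comp_sum (b.+1 - a) = (a == b :> nat)%:R + odd_inv (b - a).
    have := ltn_ord a; rewrite ltnS => ab; rewrite subSn // /odd_comp_sum /=.
    by rewrite add0r eqSS subn_eq0; congr (_%:R + _); lia.
  rewrite mulrDr; over.
rewrite big_split /= [odd_inv b.+1]odd_invE /=.
rewrite big_ord_recr /= eqxx mulr1 big1 => [|i _]; last first.
  by rewrite (ltn_eqF (ltn_ord i)) mulr0.
rewrite /odd_comp_sum /=; ring.
Qed.

(** * The power series identity modulo ['X^K] *)

Section TruncatedIdentity.
Variable K : nat.

(** The explicit quotient [w] lets a congruence be pushed through composition and through evaluation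
    in an algebra. *)
Definition cong_Xn (p q : {poly rat}) : Prop := exists w, p = q + w * 'X^K.

Lemma cong_XnP (p q : {poly rat}) :
  (forall i, (i < K)%N -> p`_i = q`_i) -> cong_Xn p q.
Proof.
move=> pq; exists (drop_poly K (p - q)).
have H : take_poly K (p - q) = 0.
  apply/polyP=> i; rewrite coef_take_poly coef0; case: ifP => // iK.
  by rewrite coefB pq ?subrr.
by have := poly_take_drop K (p - q); rewrite H add0r => ->; ring.
Qed.

Let invp : {poly rat} := \poly_(i < K) (odd_inv i)%:~R.
Let sump : {poly rat} := \poly_(i < K) (odd_comp_sum i)%:~R.

Lemma invp_quadratic : cong_Xn invp ('X * (1 - invp ^+ 2)).
Proof.
apply: cong_XnP => i iK; rewrite coef_poly iK coefXM.
case: i iK => [|i] iK /=; first by rewrite odd_inv_even.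
rewrite coefB coef1 expr2 coefM odd_invE /= rmorphB /= rmorph_sum /=.
rewrite eqSS; congr (_ - _); first by case: eqP.
apply: eq_bigr => j _; rewrite !coef_poly rmorphM /=.
by have := ltn_ord j => ji; rewrite !ifT //; lia.
Qed.

Lemma sump_invp : cong_Xn sump (1 + 'X + 'X * invp).
Proof.
apply: cong_XnP => i iK; rewrite coef_poly iK !coefD coef1 coefX coefXM.
rewrite /odd_comp_sum 2!rmorphD /= !rmorph_nat; congr (_ + _ + _).
case: i iK => [|i] iK /=; first by rewrite odd_inv_even.
by rewrite coef_poly ifT //; lia.
Qed.

Let g : {poly rat} := 1 + 2 * 'X.
(** The geometric series of [1 / (1 + 2 X)], truncated: with [G = 1 + 2 X] it plays the role of
    [G^-1], and [odd_part_trunc] that of [(G - G^-1) / 4]. *)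
Definition inv_trunc : {poly rat} := \sum_(i < K) (- (2 * 'X)) ^+ i.
Definition odd_part_trunc : {poly rat} := 4^-1%:P * (1 + 2 * 'X - inv_trunc).

Lemma inv_trunc_cong : cong_Xn (g * inv_trunc) 1.
Proof.
exists (- (- 2) ^+ K).
have := subrX1 (- (2 * 'X) : {poly rat}) K; rewrite -/inv_trunc => E.
rewrite mulNr -exprMn mulNr -[X in _ = _ - X](subrK 1) E /g; ring.
Qed.

Let u := odd_part_trunc.

Hypothesis K_gt0 : (0 < K)%N.

(** As [K > 0], [inv_trunc] has constant term 1 and the constant terms cancel. Hence ['X^K] divides
    [u ^+ K], and congruences survive composition with [u]. *)
Lemma u_div : exists v, u = v * 'X.
Proof.
suff /dvdpP[v ->] : 'X %| u by exists v.
rewrite -['X]subr0 -[0]/(0%:P) dvdp_XsubCl; apply/rootP.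
rewrite /u /odd_part_trunc /inv_trunc; case: K K_gt0 => // k _.
rewrite big_ord_recl expr0 !hornerE horner_sum big1 => [|i _].
  by rewrite addr0 subrr mulr0.
by rewrite lift0 exprSr !hornerE.
Qed.

(** Both sides are roots of [Y ^ 2 - Y = u (2 Y - 1)] modulo ['X^K], and the
    other factor of the difference has constant coefficient 1. *)
Lemma truncated_identity : cong_Xn (sump \Po u) (1 + 'X).
Proof.
have [v uv] := u_div.
have uK : u ^+ K = v ^+ K * 'X^K by rewrite uv exprMn.
have [w1 /(congr1 (fun p => p \Po u))] := invp_quadratic.
have [w2 /(congr1 (fun p => p \Po u))] := sump_invp.
rewrite expr2 !(comp_polyB, comp_polyD, comp_polyM, comp_polyX, comp_polyC,
  comp_Xn_poly) uK polyC1.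
set P := sump \Po u; set C := invp \Po u; set W1 := w1 \Po u; set W2 := w2 \Po u.
move=> EP EC.
have [w3 E3] := inv_trunc_cong.
pose P0 := 1 + u + u * C.
have : 'X^K %| (P - (1 + 'X)) * (P + 'X - 2 * u).
  apply/dvdpP.
  (* The three errors: [W1] from [C = u (1 - C ^ 2)], [W2] from replacing [P] by [P0], and [w3] from
     the truncated inverse of [g]. *)
  exists (v ^+ K * (u * W1 + W2 * (2 * P0 + W2 * (u ^+ K) - 1 - 2 * u))
     - 4^-1%:P * w3).
  have E4 : 4 * (4^-1)%:P = 1 :> {poly rat}.
    by rewrite -[4]/(4%:R) -polyC_natr -polyCM divff.
  have EC' : C - u * (1 - C * C) = W1 * (v ^+ K * 'X^K).
    by apply/eqP; rewrite subr_eq addrC -EC.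
  have H1 : P0 ^+ 2 - P0 - u * (2 * P0 - 1) = u * (W1 * (v ^+ K * 'X^K)).
    by rewrite -EC' /P0; ring.
  have H2 : (1 + 'X) ^+ 2 - (1 + 'X) - u * (2 * (1 + 'X) - 1)
      = (4^-1)%:P * w3 * 'X^K.
    have E3' : w3 * 'X^K = g * inv_trunc - 1 by rewrite E3; ring.
    rewrite -mulrA E3' /u /odd_part_trunc /g.
    transitivity (4 * (4^-1)%:P * ('X ^+ 2 + 'X)
      - (4^-1)%:P * (1 + 2 * 'X - inv_trunc) * (2 * (1 + 'X) - 1) : {poly rat}).
      by rewrite E4; ring.
    by ring.
  rewrite EP uK -/P0.
  transitivity ((P0 ^+ 2 - P0 - u * (2 * P0 - 1))
     - ((1 + 'X) ^+ 2 - (1 + 'X) - u * (2 * (1 + 'X) - 1))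
     + v ^+ K * 'X^K * W2 * (2 * P0 + W2 * (v ^+ K * 'X^K) - 1 - 2 * u)).
    by ring.
  by rewrite H1 H2; ring.
rewrite Gauss_dvdpl => [/dvdpP[q Eq]|].
  by exists q; rewrite -Eq; ring.
rewrite coprimep_sym coprimep_expr //.
suff : coprimep (P + 'X - 2 * u) ('X - 0%:P) by rewrite polyC0 subr0.
rewrite coprimep_XsubC EP uv rootE.
rewrite !hornerE expr0n eqn0Ngt K_gt0 /= !mulr0 subr0 addr0.
exact: oner_neq0.
Qed.

End TruncatedIdentity.

(** * Evaluation at a nilpotent element *)

Section Specialization.
Variables (A : algType rat) (K : nat) (G G' : A).

Hypotheses (K_gt0 : (0 < K)%N) (G_unip : (2^-1 *: (G - 1)) ^+ K = 0).
Hypotheses (GG' : G' * G = 1).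

(** Evaluate at [N = (G - 1) / 2]. There ['X^K] vanishes, so congruences become equations; [1 + 2 X]
    becomes [G], [inv_trunc] becomes [G'], and [1 + X] becomes [(G + 1) / 2]. *)
Lemma sum_odd_comp_sum_exp :
  \sum_(r < K) (odd_comp_sum r)%:~R *: (4^-1 *: (G - G')) ^+ r
    = 2^-1 *: (G + 1).
Proof.
pose N := 2^-1 *: (G - 1); pose ev : {rmorphism {poly rat} -> A} := horner_alg N.
have evX : ev 'X = N by exact: horner_algX.
have evXn : ev 'X^K = 0 by rewrite rmorphXn /= evX.
have evC c : ev c%:P = c%:A by exact: horner_algC.
have ev2N : ev (1 + 2 * 'X) = G.
  rewrite rmorphD rmorphM /= rmorph1 rmorph_nat evX /N mulr_natl -scaler_nat.
  by rewrite scalerA divff // scale1r addrC subrK.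
have [w1 /(congr1 ev)] := inv_trunc_cong K.
rewrite rmorphM ev2N rmorphD rmorph1 (rmorphM _ w1) /= evXn mulr0 addr0 => GT.
have evT : ev (inv_trunc K) = G'.
  by rewrite -[RHS]mulr1 -GT mulrA GG' mul1r.
have evu : ev (odd_part_trunc K) = 4^-1 *: (G - G').
  by rewrite /odd_part_trunc rmorphM /= evC rmorphB /= ev2N evT mulr_algl.
have [w2 /(congr1 ev)] := truncated_identity K_gt0.
rewrite !rmorphD rmorph1 evX (rmorphM _ w2) /= evXn mulr0 addr0 => E.
transitivity (1 + N); last first.
  have E1 : 1 = 2^-1 *: (1 + 1) :> A.
    by rewrite -mulr2n -scaler_nat scalerA mulVf ?scale1r.
  by rewrite {1}E1 /N -scalerDr addrC addrA subrK.
rewrite -E poly_def !raddf_sum /=; apply: eq_bigr => r _.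
by rewrite comp_polyZ comp_Xn_poly -mul_polyC rmorphM /= evC mulr_algl rmorphXn /= evu.
Qed.

End Specialization.

(** * Möbius function of odd compositions *)

Section MoebiusInversion.
Context {d : Order.disp_t} {T : finPOrderType d}.
Implicit Types x y z : T.

Lemma sum_moebius x y :
  \sum_(z | (x <= z <= y)%O) moebius x z = (x == y)%:R.
Proof.
case: (boolP (x <= y)%O) => [xy|nxy]; last first.
  rewrite big_pred0 => [|z]; last by apply: contraNF nxy => /andP[]; apply: le_trans.
  by case: eqP nxy => // ->; rewrite lexx.
rewrite (bigD1 y) ?xy ?lexx //= moebiusE.
case: eqP => [<-|/eqP nxy].
  rewrite big_pred0 ?addr0 // => z; apply/negbTE/negP => /andP[zx].
  by rewrite -eq_le in zx; rewrite eq_sym zx.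
rewrite lt_neqAle nxy xy /= addrC [X in X - _](_ : _ =
  \sum_(z | (x <= z < y)%O) moebius x z) ?subrr //.
by apply: eq_bigl => z; rewrite lt_neqAle -andbA [(_ <= y)%O && _]andbC.
Qed.

(** Associativity in the incidence algebra: zeta times [f] is the delta at [y], and by [sum_moebius]
    the Möbius function is a left inverse of zeta. *)
Lemma moebius_of_upper_sums (f : T -> int) y :
  (forall x, \sum_(z | (x <= z)%O) f z = (x == y)%:R) ->
  forall x, moebius x y = f x.
Proof.
move=> fP x.
have -> : moebius x y = \sum_(a | (x <= a)%O) moebius x a * (a == y)%:R.
  case: (boolP (x <= y)%O) => xy.
    rewrite (bigD1 y) //= eqxx mulr1 big1 ?addr0 // => a /andP[_ /negbTE->].
    by rewrite mulr0.
  rewrite big1 => [|a xa]; last first.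
    by case: eqP xa xy => [-> ->|_ _ _] //; rewrite mulr0.
  rewrite moebiusE lt_neqAle (negbTE xy) andbF.
  by case: eqP xy => // ->; rewrite lexx.
under eq_bigr => a _ do rewrite -fP mulr_sumr.
rewrite (exchange_big_dep (fun z => (x <= z)%O)) /=; last first.
  by move=> a z; apply: le_trans.
transitivity (\sum_(z | (x <= z)%O) (x == z)%:R * f z).
  by apply: eq_bigr => z _; rewrite -sum_moebius mulr_suml.
rewrite (bigD1 x) //= eqxx mul1r big1 ?addr0 // => z /andP[_].
by rewrite eq_sym => /negbTE->; rewrite mul0r.
Qed.

End MoebiusInversion.

Definition odd_comps (l : nat) : seq (seq nat) :=
  [seq comp_val (oddcomp_val z) | z <- enum {: oddcomp l}].

Lemma all_odd_pos s : all odd s -> all (leq 1) s.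
Proof. by apply: sub_all => -[]. Qed.

Lemma mem_odd_comps l s : (s \in odd_comps l) = all odd s && (sumn s == l).
Proof.
apply/mapP/andP => [[z _ ->]|[so sl]].
  by split; [exact: oddcompP | case/andP: (compP z)].
have sP : is_comp l s by rewrite /is_comp all_odd_pos.
by exists (@OddComp l (Composition sP) so); rewrite ?mem_enum.
Qed.

Lemma uniq_odd_comps l : uniq (odd_comps l).
Proof. by rewrite map_inj_uniq ?enum_uniq // => x y /val_inj/val_inj. Qed.

Definition odd_refinements (b : seq nat) : seq (seq nat) :=
  foldr (fun x ss => [seq s ++ t | s <- odd_comps x, t <- ss]) [:: [::]] b.

(** Odd entries are positive, so the prescribed sum [x] determines where a concatenation is cut. *)
Lemma uniq_odd_refinements b : uniq (odd_refinements b).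
Proof.
elim: b => //= x b IH; apply: allpairs_uniq; rewrite ?uniq_odd_comps //.
have step a1 a2 s1 s2 : all odd a1 -> all odd a2 -> sumn a1 = sumn a2 ->
    a1 ++ s1 = a2 ++ s2 -> a1 = a2 /\ s1 = s2.
  elim: a1 a2 => [|y a1 IHa] [|z a2] //=.
  - by case: z.
  - by case: y.
  move=> /andP[_ a1o] /andP[_ a2o] + [yz E]; rewrite yz => /addnI sE.
  by have [-> ->] := IHa _ a1o a2o sE E.
move=> _ _ /allpairsP[[a1 s1] /= [+ _ ->]] /allpairsP[[a2 s2] /= [+ _ ->]] /=.
rewrite !mem_odd_comps => /andP[a1o /eqP <-] /andP[a2o /eqP sE] E.
by have [-> ->] := step _ _ _ _ a1o a2o (esym sE) E.
Qed.

Lemma mem_odd_refinements b s : all odd b ->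
  (s \in odd_refinements b) = all odd s && coarser sumn b s.
Proof.
move=> bo; apply/idP/andP => [|[+ /coarserP[r [_ rs rb]]]].
  elim: b bo s => [|x b IH] /= bo s.
    by rewrite inE => /eqP->; split=> //; apply: coarser_refl; apply: sumn1.
  case/andP: bo => xo /IH {}IH.
  case/allpairsP => -[u v] /= [+ /IH[vo /coarserP[r [r0 rv rb]]] ->].
  rewrite mem_odd_comps => /andP[uo /eqP ux]; split; first by rewrite all_cat uo.
  apply/coarserP; exists (u :: r); rewrite /= r0 rv ux rb; split=> //.
  by rewrite andbT; apply: contraTneq xo => u0; rewrite -ux u0.
rewrite -{}rb -{}rs {bo}; elim: r => [|u r IH] //=.
rewrite all_cat => /andP[uo /IH ro]; apply: allpairs_f => //.
by rewrite mem_odd_comps uo eqxx.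
Qed.

(** Splitting off the first part [a] gives the recursion [odd_comp_sum_rec], whose terms with even
    [a] vanish by [odd_inv_even]. *)
Lemma sum_odd_comps l : 
  \sum_(s <- odd_comps l) \prod_(x <- s) odd_inv x = odd_comp_sum l.
Proof.
elim/ltn_ind: l => -[|l] IH.
  rewrite (perm_big [:: [::]]); first by rewrite big_seq1 big_nil /odd_comp_sum odd_inv_even.
  apply: uniq_perm; rewrite ?uniq_odd_comps // => s; rewrite mem_odd_comps inE.
  by case: s => //= -[|x] s //=; rewrite andbF.
rewrite odd_comp_sum_rec.
have mem_as a : (a \in [seq a <- iota 0 l.+2 | odd a]) = odd a && (a < l.+2)%N.
  by rewrite mem_filter mem_iota.
rewrite (perm_big [seq a :: t | a <- [seq a <- iota 0 l.+2 | odd a],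
                                t <- odd_comps (l.+1 - a)]).
  rewrite big_allpairs_dep big_filter.
  rewrite -(big_mkord predT (fun a => odd_inv a * odd_comp_sum (l.+1 - a))).
  rewrite big_mkcond /index_iota subn0 big_seq_cond [RHS]big_seq_cond.
  apply: eq_bigr => a; rewrite andbT mem_iota => /andP[_ al].
  case: ifPn => [ao|ae]; last by rewrite odd_inv_even ?mul0r.
  rewrite -IH; last by case: a ao {al}; lia.
  by rewrite mulr_sumr; apply: eq_bigr => t _; rewrite big_cons.
apply: uniq_perm; first exact: uniq_odd_comps.
  apply: allpairs_uniq_dep => [|a _|]; rewrite ?filter_uniq ?iota_uniq ?uniq_odd_comps //.
  by move=> [a1 t1] [a2 t2] _ _ /= [-> ->].
move=> s; rewrite mem_odd_comps; apply/andP/allpairsPdep => [|[a [t]]].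
  case: s => [|a t] /= [] // /andP[ao to] /eqP sl; exists a, t.
  rewrite mem_as mem_odd_comps ao to -sl addKn eqxx; split=> //.
  by rewrite ltnS leq_addr.
rewrite mem_as mem_odd_comps => -[/andP[ao al] /andP[to /eqP st] ->] /=.
by rewrite ao to st; split=> //; apply/eqP; lia.
Qed.

Lemma sum_odd_refinements b :
  \sum_(s <- odd_refinements b) \prod_(x <- s) odd_inv x =
  \prod_(x <- b) odd_comp_sum x.
Proof.
elim: b => [|x b IH] /=; first by rewrite big_seq1 !big_nil.
rewrite big_allpairs_dep big_cons -IH -sum_odd_comps mulr_suml.
apply: eq_bigr => s _; rewrite mulr_sumr; apply: eq_bigr => t _.
by rewrite big_cat.
Qed.

(** The sum of these products over the refinements of [b] factors over the parts of [b]. An odd part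
    [x] contributes [odd_comp_sum x], which is 1 if [x = 1] and 0 otherwise because [x - 1] is
    even. *)
Lemma moebius_oddcomp_ones l (b : oddcomp l) :
  moebius b (oddcomp_ones l) = \prod_(x <- b) odd_inv x.
Proof.
apply: (moebius_of_upper_sums (f := fun b : oddcomp l => \prod_(x <- b) odd_inv x)) => {}b.
transitivity (\sum_(s <- odd_refinements b) \prod_(x <- s) odd_inv x).
  rewrite (perm_big [seq comp_val (oddcomp_val z) | z <- enum {: oddcomp l} & (b <= z)%O]).
    by rewrite big_map big_filter big_enum_cond.
  apply: uniq_perm; first exact: uniq_odd_refinements.
    rewrite map_inj_uniq; first exact/filter_uniq/enum_uniq.
    by move=> x y /val_inj/val_inj.
  move=> s; rewrite mem_odd_refinements ?oddcompP //.
  apply/andP/mapP => [[so bs]|[z + ->]]; last first.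
    by rewrite mem_filter => /andP[bz _]; split; [exact: oddcompP | exact: bz].
  have sl : s \in odd_comps l.
    rewrite mem_odd_comps so; case/coarserP: bs => r [_ <- rb].
    by rewrite -sumn_map_sumn rb; case/andP: (compP b).
  case/mapP: sl => z _ E; exists z => //.
  by rewrite mem_filter mem_enum andbT E in bs *.
rewrite sum_odd_refinements.
have bo := oddcompP b.
have E x : odd x -> odd_comp_sum x = (x == 1)%:R.
  case: x => // x xo; rewrite /odd_comp_sum odd_inv_even ?addr0 ?add0r //.
have -> : (b == oddcomp_ones l) = all (pred1 1) (b : seq nat).
  apply/eqP/idP => [->|/all_pred1P]; first by rewrite /= all_nseq /= orbT.
  move=> bE; apply/val_inj/val_inj => /=; rewrite bE; congr (nseq _ _).
  by case/andP: (compP b) => _ /eqP; rewrite {1}bE sumn_nseq mul1n.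
elim: (b : seq nat) bo => [|x s IH] /=; first by rewrite big_nil.
case/andP=> xo /IH; rewrite big_cons E // => ->.
by case: (x == 1); case: all; rewrite ?mul1r ?mul0r.
Qed.

Lemma mu_oddE l : mu_odd l = odd_comp_sum l.
Proof.
rewrite -sum_odd_comps /odd_comps big_map big_enum; apply: eq_bigr => b _.
exact: moebius_oddcomp_ones.
Qed.

(** * The order on points induced by a set composition *)

Section BlockOrder.
Variable n : nat.
Implicit Types (s t : seq {set 'I_n}) (x y z : 'I_n) (P A B : {set 'I_n}).

(** The block of [x] is not later than that of [y]; points outside all blocks
    count as coming last. *)
Fixpoint before s x y : bool :=
  if s is B :: s' then (x \in B) || (y \notin B) && before s' x y else true.

Definition covered s x : bool := has (fun B : {set 'I_n} => x \in B) s.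

Lemma before_total s x y : before s x y || before s y x.
Proof. by elim: s => //= B s; case: (x \in B); case: (y \in B). Qed.

Lemma before_refl s x : before s x x.
Proof. by have := before_total s x x; rewrite orbb. Qed.

Lemma before_trans s y x z : before s x y -> before s y z -> before s x z.
Proof.
elim: s => //= B s IH; case: (x \in B) => //= /andP[/negbTE-> /= xy].
by case/andP=> -> /(IH xy).
Qed.

Lemma before_uncovered s x y : ~~ covered s x -> before s x y = ~~ covered s y.
Proof.
by elim: s => //= B s IH; rewrite !negb_or => /andP[/negbTE-> /IH ->].
Qed.

Lemma before_covered s x y : ~~ covered s y -> before s x y.
Proof. by elim: s => //= B s IH; rewrite negb_or => /andP[-> /IH ->]; rewrite orbT. Qed.

Lemma before_cat s t x y :
  before (s ++ t) x y =
    if covered s x || covered s y then before s x y else before t x y.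
Proof.
elim: s => //= B s ->; case: (x \in B) => //=; case: (y \in B) => //=.
by rewrite orbT.
Qed.

Lemma before_filter s x y : before [seq B <- s | B != set0] x y = before s x y.
Proof.
elim: s => //= B s IH; case: eqP => [->|_] /=; last by rewrite IH.
by rewrite !inE IH.
Qed.

Lemma covered_capmap P t x : covered [seq P :&: Q | Q <- t] x = (x \in P) && covered t x.
Proof.
elim: t => [|Q t /= ->] /=; first by rewrite andbF.
by rewrite inE; case: (x \in P).
Qed.

Lemma before_capmap P t x y : x \in P -> y \in P ->
  before [seq P :&: Q | Q <- t] x y = before t x y.
Proof. by move=> xP yP; elim: t => //= Q t ->; rewrite !inE xP yP. Qed.

(** The meet orders points lexicographically: [s] decides first, and inside a block [P] of [s] the
    sets [P :&: Q] come in the order of the blocks [Q] of [t]. *)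
Lemma before_meet_seq s t x y : covered s x -> covered t x -> covered t y ->
  before (meet_seq s t) x y = before s x y && (before s y x ==> before t x y).
Proof.
rewrite /meet_seq before_filter => + tx ty; elim: s => //= P s IH.
rewrite before_cat !covered_capmap tx ty !andbT.
case xP: (x \in P); case yP: (y \in P) => //=.
- by rewrite before_capmap ?xP.
- by rewrite before_covered // covered_capmap yP.
- by rewrite before_uncovered covered_capmap ?xP ?yP ?ty.
Qed.

Lemma before_merge (r : seq (seq {set 'I_n})) x y :
  before (flatten r) x y -> before [seq union_seq b | b <- r] x y.
Proof.
elim: r => //= b r IH; rewrite before_cat /union_seq !bigcup_seqE -!/(covered _ _).
case bx: (covered b x) => //=; case: (boolP (covered b y)) => //= bY.
by rewrite before_uncovered ?bx // bY.
Qed.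

Lemma before_coarser s t x y :
  coarser (@union_seq n) s t -> before t x y -> before s x y.
Proof. by case/coarserP => r [_ <- <-]; apply: before_merge. Qed.

Lemma mem_head_before A s x : A != set0 ->
  (x \in A) = covered (A :: s) x &&
    [forall y, covered (A :: s) y ==> before (A :: s) x y].
Proof.
case/set0Pn=> a aA; apply/idP/andP => [xA|[_ /forallP/(_ a)]] /=.
  by rewrite xA; split=> //; apply/forallP => y; rewrite implybT.
by rewrite aA /= orbF.
Qed.

(** By [mem_head_before] the first block is the set of least covered points, so it is the same in
    both lists and can be removed. *)
Lemma before_inj s t :
    all (fun B => B != set0) s -> all (fun B => B != set0) t ->
    pairwise (fun A B : {set 'I_n} => [disjoint A & B]) s ->
    pairwise (fun A B : {set 'I_n} => [disjoint A & B]) t ->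
    covered s =1 covered t ->
    (forall x y, covered s x -> covered s y -> before s x y = before t x y) ->
  s = t.
Proof.
elim: s t => [|A s IH] [|B t] //=.
- by move=> _ /andP[/set0Pn[b bB] _] _ _ /(_ b) /=; rewrite bB.
- by move=> /andP[/set0Pn[b bB] _] _ _ _ /(_ b) /=; rewrite bB.
move=> /andP[A0 s0] /andP[B0 t0] /andP[As sd] /andP[Bt td] cov bef.
have AB : A = B.
  apply/setP => x; rewrite (mem_head_before s x A0) (mem_head_before t x B0).
  rewrite -cov; case: (boolP (covered _ _)) => //= cx.
  apply: eq_forallb => y; rewrite -[(y \in B) || _]cov /=.
  by case: (boolP (_ || _)) => //= cy; rewrite (bef x y cx cy).
rewrite -{B}AB in B0 Bt cov bef *; congr (_ :: _).
have out u x :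
    all (fun B : {set 'I_n} => [disjoint A & B]) u -> covered u x -> x \notin A.
  by move=> /allP Au /hasP[C /Au dAC xC]; rewrite (disjointFl dAC xC).
apply: IH => // [x|x y cx cy].
  have := cov x; rewrite /=; case xA: (x \in A) => //= _.
  by apply/idP/idP => [/(out _ _ As)|/(out _ _ Bt)]; rewrite xA.
have := bef x y; rewrite (negbTE (out _ _ As cx)) (negbTE (out _ _ As cy)) /=.
exact.
Qed.

Lemma mem_block s x : pairwise (fun A B : {set 'I_n} => [disjoint A & B]) s ->
  covered s x -> [set y | before s x y && before s y x] \in s.
Proof.
elim: s => //= A s IH /andP[As sd]; rewrite inE.
case: (boolP (x \in A)) => [xA _|xA /= cx].
  by apply/orP; left; apply/eqP/setP => y; rewrite inE /= orbF.
apply/orP; right.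
rewrite (_ : finset _ = [set y | before s x y && before s y x]) ?IH //.
apply/setP => y; rewrite !inE; case yA: (y \in A) => //=.
apply/esym/negbTE/negP => /andP[_ yx].
have cy : covered s y.
  by apply: contraTT yx => cy; rewrite before_uncovered // cx.
by case/hasP: cy => C /(allP As) dAC yC; rewrite (disjointFl dAC yC) in yA.
Qed.

End BlockOrder.

Section SetCompositions.
Variable n : nat.
Implicit Types (phi psi chi xi : setcomp n) (x y : 'I_n).

Lemma setcomp_covered chi x : covered chi x.
Proof.
by have /and3P[_ _ /eqP/setP/(_ x)] := setcompP chi; rewrite bigcup_seqE inE.
Qed.

Lemma setcomp_disjoint chi : pairwise (fun A B : {set 'I_n} => [disjoint A & B]) chi.
Proof. by have /and3P[] := setcompP chi. Qed.

Lemma setcomp_neq0 chi : all (fun B => B != set0) chi.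
Proof. by have /and3P[] := setcompP chi. Qed.

Lemma setcomp_uniq chi : uniq chi.
Proof.
rewrite uniq_pairwise.
have := setcomp_disjoint chi; have := setcomp_neq0 chi.
elim: (chi : seq _) => //= A s IH /andP[A0 /IH {}IH] /andP[As /IH ->].
rewrite andbT; apply: sub_all As => B; apply: contraTneq => <-.
by rewrite -setI_eq0 setIid.
Qed.

Lemma setcomp_before_inj phi psi : before phi =2 before psi -> phi = psi.
Proof.
move=> E; apply/val_inj/before_inj; rewrite ?setcomp_neq0 ?setcomp_disjoint //.
by move=> x; rewrite !setcomp_covered.
Qed.

Lemma before_meet psi chi x y : before (setcomp_meet psi chi) x y =
  before psi x y && (before psi y x ==> before chi x y).
Proof. by rewrite before_meet_seq ?setcomp_covered. Qed.

Lemma before_le psi phi x y : (psi <= phi)%O -> before phi x y -> before psi x y.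
Proof. exact: before_coarser. Qed.

Definition block_of chi x : {set 'I_n} := [set y | before chi x y && before chi y x].

Lemma mem_block_of chi x : block_of chi x \in (chi : seq _).
Proof. exact: mem_block (setcomp_disjoint chi) (setcomp_covered chi x). Qed.

Lemma block_ofE chi A x : A \in (chi : seq _) -> x \in A -> A = block_of chi x.
Proof.
case/(nthP set0) => i ic <- xi; have := mem_block_of chi x.
have xB : x \in block_of chi x by rewrite inE before_refl.
case/(nthP set0) => j jc E; rewrite -E in xB *; apply/eqP.
rewrite nth_uniq ?setcomp_uniq //.
have dis := pairwiseP set0 (setcomp_disjoint chi).
case: (ltngtP i j) => // lt.
  by have := dis _ _ ic jc lt => /disjointFr/(_ xi); rewrite xB.
by have := dis _ _ jc ic lt => /disjointFr/(_ xB); rewrite xi.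
Qed.

Lemma mem_setcompP chi A :
  reflect (exists x, A = block_of chi x) (A \in (chi : seq _)).
Proof.
apply: (iffP idP) => [Ac|[x ->]]; last exact: mem_block_of.
have /set0Pn[x xA] := allP (setcomp_neq0 chi) A Ac.
by exists x; apply: block_ofE.
Qed.

Lemma perm_eq_setcomp_permute phi xi :
  perm_eq xi phi -> exists tau : 'S_(size phi), setcomp_permute tau = xi.
Proof.
move=> /(@tuple_permP _ _ _ (in_tuple phi))[tau xiE]; exists tau; apply/val_inj.
rewrite /= xiE /= /permute_seq /image_mem /=; apply: eq_map => i.
by rewrite (tnth_nth set0).
Qed.

(** * Membership in [setcomp_D] through the local order *)

Section DCharacterization.
Variables phi psi : setcomp n.
Hypothesis psi_le : (psi <= phi)%O.

(** Since [psi <= phi], [before phi x y] implies [before psi x y]; adding [before psi y x] puts both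
    points in one block of [psi]. *)
Definition local_before x y : bool := before psi y x && before phi x y.

(** As [phi] is the meet of [psi] with some [xi >= chi], inside a block of [psi] the order of [phi]
    is that of [xi], and merging blocks of [xi] only adds ties. *)
Lemma setcomp_D_before chi : chi \in setcomp_D phi psi ->
  forall x y, local_before x y -> before chi x y.
Proof.
rewrite inE => /andP[_ /existsP[xi /andP[/imsetP[tau + ->] le]]] x y /andP[yx xy].
rewrite inE => /eqP meetE; apply: before_le le _.
by move: xy; rewrite -{1}meetE before_meet yx => /andP[].
Qed.

Variable chi : setcomp n.
Hypothesis chiP : forall x y, local_before x y -> before chi x y.

Lemma block_local x y : before phi x y -> before phi y x -> before chi x y.
Proof. by move=> xy yx; apply: chiP; rewrite /local_before xy (before_le psi_le). Qed.

(** By [block_local] no block of [phi] is cut by [chi], so the meet only rearranges the blocks of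
    [phi]. *)
Lemma meet_perm_eq : perm_eq (setcomp_meet chi phi) phi.
Proof.
apply: uniq_perm; rewrite ?setcomp_uniq // => A.
have E x : block_of (setcomp_meet chi phi) x = block_of phi x.
  apply/setP => y; rewrite !inE !before_meet.
  apply/idP/idP.
    by case/and3P => /andP[cxy imp] cyx; rewrite cxy cyx /= in imp *; rewrite imp.
  by case/andP => xy yx; rewrite xy yx !implybT !block_local.
by apply/mem_setcompP/mem_setcompP => -[x ->]; exists x.
Qed.

(** Across blocks of [psi] the order of [phi] is that of [psi]. Inside one, [chiP] makes [chi] agree
    with [phi] up to ties, which [phi] then breaks. *)
Lemma meet_meet : setcomp_meet psi (setcomp_meet chi phi) = phi.
Proof.
apply: setcomp_before_inj => x y; rewrite !before_meet.
apply/idP/idP => [/andP[pxy imp]|xy].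
  apply: contraTT imp => nxy; have yx : before phi y x.
    by have := before_total phi x y; rewrite (negbTE nxy).
  have cyx : before chi y x by apply: chiP; rewrite /local_before pxy yx.
  by rewrite (before_le psi_le yx) /= (negbTE nxy) cyx andbF.
rewrite (before_le psi_le xy) xy implybT andbT /=; apply/implyP => pyx.
by apply: chiP; rewrite /local_before pyx xy.
Qed.

Lemma le_meet : (chi <= setcomp_meet chi phi)%O.
Proof.
apply/coarserP; exists [seq [seq B <- [seq P :&: Q | Q <- phi] | B != set0] | P <- chi].
have inter (P : {set 'I_n}) x :
    x \in P -> x \in union_seq [seq B <- [seq P :&: Q | Q <- phi] | B != set0].
  move=> xP; rewrite /union_seq bigcup_seqE.
  have /hasP[Q Qp xQ] := setcomp_covered phi x.
  have xPQ : x \in P :&: Q by rewrite inE xP.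
  apply/hasP; exists (P :&: Q) => //; rewrite mem_filter map_f // andbT.
  by apply/set0Pn; exists x.
split.
- rewrite all_map; apply/allP => P Pc /=.
  have /set0Pn[x /inter] := allP (setcomp_neq0 chi) P Pc.
  by rewrite /union_seq; case: filter => //; rewrite big_nil inE.
- rewrite /= /meet_seq; elim: (chi : seq _) => //= P s ->.
  by rewrite filter_cat.
- rewrite -map_comp -[RHS]map_id; apply: eq_map => P /=.
  apply/setP => x; apply/idP/idP => [|/inter //].
  rewrite /union_seq bigcup_seqE => /hasP[B]; rewrite mem_filter => /andP[_].
  by case/mapP => Q _ ->; rewrite inE => /andP[].
Qed.

(** The required element of [setcomp_C] above [chi] is the meet of [chi] and [phi]. *)
Lemma before_setcomp_D : setcomp_odd chi -> chi \in setcomp_D phi psi.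
Proof.
move=> chi_odd; rewrite inE chi_odd; apply/existsP; exists (setcomp_meet chi phi).
rewrite le_meet andbT; have [tau tauE] := perm_eq_setcomp_permute meet_perm_eq.
by rewrite -tauE; apply: imset_f; rewrite inE tauE meet_meet.
Qed.

End DCharacterization.
End SetCompositions.

(** * Lower sets *)

Section Support.
Variables (n : nat) (psi : setcomp n).
Implicit Types (A B : {set 'I_n}) (chi : setcomp n).

Definition nb_meeting B : nat := count (fun P : {set 'I_n} => P :&: B != set0) psi.

(** Makes the power of 2 with this exponent a product over the blocks of [chi], hence a weight on
    chains. *)
Lemma size_setcomp_meet chi :
  size (setcomp_meet psi chi) = (\sum_(B <- chi) nb_meeting B)%N.
Proof.
rewrite /= /meet_seq size_filter -sum1_count big_mkcond big_allpairs_dep /=.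
rewrite exchange_big /=; apply: eq_bigr => B _.
by rewrite /nb_meeting -sum1_count [RHS]big_mkcond.
Qed.

Lemma nb_meeting0 : nb_meeting set0 = 0%N.
Proof.
by rewrite /nb_meeting (eq_count (a2 := pred0)) ?count_pred0 // => P;
  rewrite setI0 eqxx.
Qed.

Lemma nb_meetingT : nb_meeting setT = size psi.
Proof.
by apply/eqP; rewrite -all_count; apply: sub_all (setcomp_neq0 psi) => P; rewrite setIT.
Qed.

Lemma nb_meetingU_block A B x : x \in B -> B \subset block_of psi x ->
  [disjoint A & block_of psi x] -> nb_meeting (A :|: B) = (nb_meeting A).+1.
Proof.
move=> xB Bx Ax; have B0 : block_of psi x \in (psi : seq _) := mem_block_of psi x.
have c1 : count_mem (block_of psi x) psi = 1%N.
  by rewrite count_uniq_mem ?setcomp_uniq ?B0.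
rewrite -addn1 -[in RHS]c1 /nb_meeting -count_predUI.
rewrite [X in (_ + X)%N](eq_count (a2 := pred0)) ?count_pred0 ?addn0; last first.
  move=> P /=; case: (P =P block_of psi x) => [->|]; rewrite ?andbF //.
  by rewrite setIC (disjoint_setI0 Ax) eqxx.
apply: eq_in_count => P Pp /=; rewrite setIUr setU_eq0 negb_and; congr (_ || _).
apply/set0Pn/eqP => [[y /setIP[yP yB]]|->]; last by exists x; rewrite inE xB (subsetP Bx).
have yx : y \in block_of psi x := subsetP Bx y yB.
by rewrite (block_ofE Pp yP) -(block_ofE B0 yx).
Qed.

End Support.

Section LowerSets.
Variables (n : nat) (phi psi : setcomp n).
Hypotheses (phi_odd : setcomp_odd phi) (psi_le : (psi <= phi)%O).
Implicit Types (S T U : {set 'I_n}) (x y : 'I_n).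
Local Notation lb := (local_before phi psi).

Definition lower S : bool := [forall y in S, forall x, lb x y ==> (x \in S)].

Lemma lowerP S : reflect (forall x y, lb x y -> y \in S -> x \in S) (lower S).
Proof.
apply: (iffP 'forall_implyP) => [H x y xy yS|H y yS]; last first.
  by apply/forallP => x; apply/implyP => xy; apply: H xy yS.
by have /forallP/(_ x)/implyP := H y yS; apply.
Qed.

Lemma lower0 : lower set0.
Proof. by apply/lowerP => x y _; rewrite inE. Qed.

Lemma lowerT : lower setT.
Proof. by apply/lowerP => x y _ _; rewrite inE. Qed.

Lemma local_before_block x y : lb x y -> block_of psi x = block_of psi y.
Proof.
case/andP=> yx xy; apply: block_ofE (mem_block_of _ _) _.
by rewrite inE yx (before_le psi_le xy).
Qed.

Lemma block_ofC (chi : setcomp n) x y : (y \in block_of chi x) = (x \in block_of chi y).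
Proof. by rewrite !inE andbC. Qed.

(** This is the entrywise form of [interval_sign_zeta], from which the weight matrix is inverted.
    With [e = (-1) ^ #|T|] the induction step reads [- e + 2 e = e]. *)
Lemma signed_interval_sum S T : lower S -> lower T -> S \subset T ->
  \sum_(U | [&& lower U, S \subset U & U \subset T])
     2 ^+ nb_meeting psi (U :\: S) * (-1) ^+ #|U| = (-1) ^+ #|T| :> rat.
Proof.
move=> lS; have [m] := ubnP #|T|; elim: m T => // m IH T Tm lT ST.
case: (eqVneq S T) => [<-|SnT].
  rewrite (big_pred1 S) ?setDv ?nb_meeting0 ?mul1r // => U /=.
  by apply/and3P/eqP => [[_ SU US]|->] //; apply/eqP; rewrite eqEsubset US SU.
have /set0Pn[x0 x0TS] : T :\: S != set0.
  by apply: contraNneq SnT => /eqP; rewrite setD_eq0 => TS; rewrite eqEsubset ST.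
(* Take [x] in [T :\: S] as late as possible in [phi]; let [P] be its block in
   [phi] and [Q] the part of [T :\: S] in its block of [psi].  The [U]
   avoiding [x] lie below [T :\: P]; the others contain [Q], and removing [Q]
   gives the sets below [T :\: Q].  Both sums are known by induction. *)
have [x xTS xmax] :
    exists2 x, x \in T :\: S & forall y, y \in T :\: S -> before phi y x.
  case: (arg_maxnP (fun y => #|[set z | before phi z y]|) x0TS) => x xTS mx.
  exists x => // y yTS; case/orP: (before_total phi y x) => // xy.
  have sub : [set z | before phi z x] \subset [set z | before phi z y].
    by apply/subsetP => z; rewrite !inE => /before_trans; apply.
  have /eqP/setP/(_ y) : [set z | before phi z x] == [set z | before phi z y].
    by rewrite eqEcard sub; apply: mx.
  by rewrite !inE before_refl.
have /setDP[xT xS] := xTS.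
pose P := block_of phi x; pose Q := (T :\: S) :&: block_of psi x.
have xP : x \in P by rewrite inE before_refl.
have xQ : x \in Q by rewrite in_setI in_setD xS xT inE before_refl.
have PT : P \subset T.
  apply/subsetP => y; rewrite inE => /andP[xy yx]; apply: (lowerP _ lT y x) => //.
  by rewrite /local_before (before_le psi_le xy).
have PU U y : lower U -> y \in P -> y \in U -> x \in U.
  move=> /lowerP lU; rewrite inE => /andP[xy yx]; apply: lU.
  by rewrite /local_before (before_le psi_le yx).
have QS y : y \in Q -> y \notin S by rewrite in_setI in_setD => /andP[/andP[]].
have QT y : y \in Q -> y \in T by rewrite in_setI in_setD => /andP[/andP[]].
have lbQ a b :
    lb a b -> b \in T -> b \notin S -> a \notin S -> a \in T ->
  (a \in Q) = (b \in Q).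
  move=> ab bT bS aS aT; rewrite !in_setI !in_setD aS bS aT bT /=.
  by rewrite block_ofC (local_before_block ab) block_ofC.
have lbQ' a b : lb a b -> a \in Q -> b \in T -> b \in Q.
  move=> ab aQ bT; have bS : b \notin S.
    by apply: contra (QS _ aQ); apply: (lowerP _ lS).
  by rewrite -(lbQ a b ab bT bS (QS _ aQ) (QT _ aQ)).
have Podd : odd #|P| by apply: (allP phi_odd); apply: mem_block_of.
have lT' : lower (T :\: P).
  apply/lowerP => a b ab /setDP[bT bP]; have aT := lowerP _ lT _ _ ab bT.
  rewrite inE aT andbT; apply: contra bP => aP; have /andP[ba ab'] := ab.
  have xb : before phi x b by move: aP; rewrite inE => /andP[/before_trans xa _]; apply: xa.
  rewrite inE xb xmax // inE bT andbT; apply: contra xS => bS.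
  by apply: PU lS aP (lowerP _ lS _ _ ab bS).
have lT'' : lower (T :\: Q).
  apply/lowerP => a b ab /setDP[bT bQ]; have aT := lowerP _ lT _ _ ab bT.
  by rewrite inE aT andbT; apply: contra bQ => aQ; apply: lbQ' ab aQ bT.
rewrite (bigID (fun U : {set _} => x \notin U)) /=.
have -> : \sum_(U | [&& lower U, S \subset U & U \subset T] && (x \notin U))
     2 ^+ nb_meeting psi (U :\: S) * (-1) ^+ #|U| = (-1) ^+ #|T :\: P| :> rat.
  rewrite -IH //; last 2 first.
  - rewrite -ltnS (leq_trans _ Tm) // ltnS; apply: proper_card; apply/properP.
    by split; [exact: subsetDl | exists x; rewrite ?in_setD ?xP].
  - rewrite subsetD ST; apply/pred0P => y /=; apply/negP => /andP[yS yP].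
    by rewrite (PU S y) in xS.
  apply: eq_bigl => U; case lU: (lower U) => //=; case: (S \subset U) => //=.
  rewrite subsetD; case: (U \subset T) => //=.
  apply/idP/idP => [xU|/disjointFl-> //].
  by apply/pred0P => y /=; apply/negP => /andP[yU yP]; rewrite (PU U y) in xU.
have -> : \sum_(U | [&& lower U, S \subset U & U \subset T] && ~~ (x \notin U))
     2 ^+ nb_meeting psi (U :\: S) * (-1) ^+ #|U| = 2 * (-1) ^+ #|T| :> rat.
  rewrite (reindex_onto (fun V => V :|: Q) (fun U => U :\: Q)) /=; last first.
    move=> U /andP[/and3P[lU SU UT]]; rewrite negbK => xU.
    apply/setP => y; rewrite !in_setU in_setD; case yQ: (y \in Q); rewrite ?orbF //=.
    apply/esym; apply: (lowerP _ lU y x) => //; move: yQ.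
    rewrite in_setI => /andP[yTS]; rewrite inE => /andP[xy _].
    by rewrite /local_before xy xmax.
  have TE : #|T| = (#|Q| + #|T :\: Q|)%N.
    by rewrite -(cardsID Q T) (setIidPr _) //; apply/subsetP.
  rewrite TE exprD mulrA -(IH (T :\: Q)) //; last 2 first.
  - rewrite -ltnS (leq_trans _ Tm) // TE ltnS -[X in (X < _)%N]add0n ltn_add2r.
    by apply/card_gt0P; exists x.
  - by rewrite subsetD ST disjoint_sym; apply/pred0P => y /=; apply/negP => /andP[/QS/negP].
  have VQ (V : {set 'I_n}) :
    V \subset T -> [disjoint V & Q] -> (V :\: S) :|: Q = (V :|: Q) :\: S.
    move=> VT dVQ; apply/setP => y; rewrite !in_setU !in_setD !in_setU.
    by case yQ: (y \in Q); rewrite ?orbF ?orbT ?andbT // QS.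
  rewrite mulr_sumr; apply: eq_big => [V|V].
    rewrite setDUl setDv setU0 negbK in_setU xQ orbT andbT.
    apply/andP/and3P => [[/and3P[/lowerP lVQ SVQ VQT] /eqP VQE]|[/lowerP lV SV]].
      have VnQ y : y \in V -> y \notin Q by rewrite -VQE => /setDP[].
      have VT : V \subset T by apply: subset_trans VQT; apply: subsetUl.
      split.
      - apply/lowerP => a b ab bV.
        have := lVQ a b ab; rewrite in_setU bV => /(_ isT); rewrite in_setU => /orP[//|aQ].
        by have := VnQ b bV; rewrite (lbQ' a b) // (subsetP VT).
      - apply/subsetP => y yS; have := subsetP SVQ y yS; rewrite in_setU => /orP[//|/QS].
        by rewrite yS.
      - by rewrite subsetD VT; apply/pred0P => y /=; apply/negP => /andP[/VnQ/negP].
    rewrite subsetD => /andP[VT dVQ]; split; last first.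
      by apply/eqP/setDidPl.
    apply/and3P; split.
    - apply/lowerP => a b ab; rewrite !in_setU => /orP[/(lV a b ab)->//|bQ].
      case: (boolP (a \in S)) => [/(subsetP SV)->//|aS].
      have aT := lowerP _ lT _ _ ab (QT _ bQ).
      by rewrite (lbQ a b ab (QT _ bQ) (QS _ bQ) aS aT) bQ orbT.
    - exact: subset_trans SV (subsetUl _ _).
    - by rewrite subUset VT; apply/subsetP.
  move=> /andP[/andP[/and3P[_ SVQ VQT] _] /eqP VQE].
  have dVQ : [disjoint V & Q].
    by rewrite -VQE; apply/pred0P => y /=; apply/negP => /andP[/setDP[_ /negP]].
  have VT : V \subset T by apply: subset_trans VQT; apply: subsetUl.
  (* [V :\: S] misses the block of [x] in [psi], so adding [Q] meets exactly one more block: this is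
     the factor 2. *)
  rewrite -VQ // (@nb_meetingU_block _ _ _ _ x) ?subsetIr //; last first.
    apply/pred0P => y /=; apply/negP => /andP[/setDP[yV yS] yx].
    by have /disjointFr/(_ yV) := dVQ; rewrite in_setI yx inE yS (subsetP VT).
  by rewrite cardsU (disjoint_setI0 dVQ) cards0 subn0 exprS exprD; ring.
have -> : (-1) ^+ #|T| = - (-1) ^+ #|T :\: P| :> rat.
  rewrite -[in LHS](cardsID P T) (setIidPr PT) exprD -[(-1) ^+ #|P|]signr_odd Podd; ring.
ring.
Qed.

End LowerSets.

Arguments lowerP {n phi psi} S.
Arguments lower0 {n phi psi}.
Arguments lowerT {n phi psi}.

(** * Chains of lower sets *)

Section Chains.
Variables (n : nat) (phi psi : setcomp n).
Hypothesis psi_le : (psi <= phi)%O.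
Implicit Types (S T U B : {set 'I_n}) (s : seq {set 'I_n}) (x y : 'I_n).
Local Notation lb := (local_before phi psi).
Local Notation lower := (lower phi psi).

(** An increasing chain from [S] to [setT], encoded by its successive differences so that [s] can be
    the block list of a set composition. *)
Fixpoint chain S s : bool :=
  if s is B :: s' then
    [&& odd #|B|, [disjoint S & B], lower (S :|: B) & chain (S :|: B) s']
  else S == setT.

(** A point enters the chain with its block of [s], and lower partial unions force [x] to enter no
    later than [y] whenever [lb x y]. *)
Lemma chainP S s : lower S ->
  reflect [/\ all (fun B => odd #|B|) s,
              pairwise (fun A B : {set 'I_n} => [disjoint A & B]) s,
              [disjoint S & union_seq s], S :|: union_seq s = setT
            & forall x y, x \notin S -> y \notin S -> lb x y -> before s x y]
          (chain S s).
Proof.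
elim: s S => [|B s IH] S lS /=.
  rewrite /union_seq big_nil setU0; apply: (iffP eqP) => [|[]//].
  by split=> //; rewrite -setI_eq0 setI0.
rewrite disjoint_bigcup_seq -/(union_seq s).
have -> : union_seq (B :: s) = B :|: union_seq s by rewrite /union_seq big_cons.
have dUr (A C D : {set 'I_n}) :
    [disjoint A & C :|: D] = [disjoint A & C] && [disjoint A & D].
  by rewrite -!setI_eq0 setIUr setU_eq0.
have dUl (A C D : {set 'I_n}) :
    [disjoint A :|: C & D] = [disjoint A & D] && [disjoint C & D].
  by rewrite -!setI_eq0 setIUl setU_eq0.
apply: (iffP and4P) => [[Bo SB lSB /(IH _ lSB)[so sd Us UT bs]]|].
  move: Us; rewrite dUl => /andP[Ss Bs].
  split; rewrite ?Bo ?Bs ?setUA ?dUr ?SB //.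
  move=> x y xS yS xy; case: (boolP (x \in B)) => //= xB.
  have yB : y \notin B.
    apply: contra xB => yB; have := lowerP _ lSB x y xy.
    by rewrite !in_setU yB orbT (negbTE xS) => /(_ isT).
  by rewrite yB bs // in_setU negb_or ?xS ?yS.
case=> /andP[Bo so] /andP[Bs sd] SBs UT bs.
move: SBs; rewrite dUr => /andP[SB Ss].
have lSB : lower (S :|: B).
  apply/lowerP => x y xy; rewrite !in_setU; case: (boolP (x \in S)) => //= xS.
  case/orP => [/(lowerP _ lS _ _ xy)|yB]; first by rewrite (negbTE xS).
  by have := bs x y xS; rewrite (disjointFl SB yB) yB orbF; apply.
split=> //; apply/(IH _ lSB); split; rewrite -?setUA ?dUl ?Ss ?Bs //.
move=> x y; rewrite !in_setU !negb_or => /andP[xS xB] /andP[yS yB] xy.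
by have := bs x y xS yS xy; rewrite (negbTE xB) yB.
Qed.

Lemma mem_setcomp_D (chi : setcomp n) :
  (chi \in setcomp_D phi psi) = chain set0 chi.
Proof.
apply/idP/(chainP _ lower0) => [cD|[co _ _ _ cb]].
  split; rewrite ?setcomp_disjoint ?set0U //.
  - by move: cD; rewrite inE => /andP[].
  - by rewrite -setI_eq0 set0I.
  - by have /and3P[_ _ /eqP] := setcompP chi.
  - by move=> x y _ _; apply: setcomp_D_before cD x y.
by apply: before_setcomp_D => // x y xy; apply: cb; rewrite ?inE.
Qed.

Lemma chain_is_setcomp s : chain set0 s -> is_setcomp s.
Proof.
case/(chainP _ lower0) => so sd _ + _; rewrite set0U /union_seq => sT.
rewrite /is_setcomp sd sT eqxx !andbT; apply: sub_all so => B; apply: contraTneq => ->.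
by rewrite cards0.
Qed.

Lemma sum_setcomp_D (w : seq {set 'I_n} -> rat) r :
  \sum_(chi in setcomp_D phi psi | size chi == r) w chi =
  \sum_(t : r.-tuple {set 'I_n} | chain set0 t) w t.
Proof.
transitivity (\sum_(s <- [seq blocks chi | chi : setcomp n <-
    enum (setcomp_D phi psi) & size chi == r]) w s).
  by rewrite big_map big_filter big_enum_cond.
transitivity (\sum_(s <- [seq tval t | t <-
    enum [pred t : r.-tuple {set 'I_n} | chain set0 t]]) w s); last first.
  by rewrite big_map big_enum.
apply: perm_big; apply: uniq_perm.
- by rewrite map_inj_uniq; [exact/filter_uniq/enum_uniq | exact: val_inj].
- by rewrite map_inj_uniq; [exact: enum_uniq | exact: val_inj].
move=> s; apply/mapP/mapP => [[chi + ->]|[t + ->]].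
  rewrite mem_filter mem_enum mem_setcomp_D => /andP[sz ch].
  by exists (Tuple sz); rewrite // mem_enum inE.
rewrite mem_enum inE => ch; exists (SetComp (chain_is_setcomp ch)) => //.
by rewrite mem_filter mem_enum mem_setcomp_D size_tuple eqxx.
Qed.

Definition lower_sets : {set {set 'I_n}} := [set S | lower S].
Local Notation N := #|lower_sets|.
Local Notation ev := (@enum_val _ (mem lower_sets)).

Definition step S T : rat :=
  if (S \subset T) && odd #|T :\: S| then 2 ^+ nb_meeting psi (T :\: S) else 0.

Definition step_mx : 'M[rat]_N := \matrix_(i, j) step (ev i) (ev j).

(** An entry of a power is a sum over paths; the first step, from [S] to [U], corresponds to the
    head block [U :\: S]. *)
Lemma step_mx_exp r (i j : 'I_N) : ev j = setT ->
  (step_mx ^+ r) i j =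
  \sum_(t : r.-tuple {set 'I_n} | chain (ev i) t)
     \prod_(B <- t) 2 ^+ nb_meeting psi B.
Proof.
move=> jT; elim: r i => [|r IH] i.
  rewrite expr0 mxE -(inj_eq enum_val_inj) jT; case: eqP => iT.
    rewrite (big_pred1 [tuple]) ?big_nil // => t.
    by rewrite (tuple0 t) /= iT !eqxx.
  by rewrite big_pred0 // => t; rewrite (tuple0 t) /=; apply/eqP.
rewrite exprS mxE; under eq_bigr => k _ do rewrite IH !mxE.
rewrite -(big_enum_val (fun U => step (ev i) U *
  \sum_(t : r.-tuple {set 'I_n} | chain U t)
     \prod_(B <- t) 2 ^+ nb_meeting psi B)).
set S := ev i.
rewrite [RHS](reindex (fun p : {set 'I_n} * r.-tuple {set 'I_n} =>
  [tuple of p.1 :: p.2])) /=; last first.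
  exists (fun t => (thead t, [tuple of behead t])) => [[B t] _|t _].
    by congr (_, _); apply: val_inj.
  by rewrite -tuple_eta.
transitivity (\sum_(B : {set 'I_n} | [&& odd #|B|, [disjoint S & B] & lower (S :|: B)])
    2 ^+ nb_meeting psi B * \sum_(t : r.-tuple {set 'I_n} | chain (S :|: B) t)
       \prod_(A <- t) 2 ^+ nb_meeting psi A : rat); last first.
  under [LHS]eq_bigr => B _ do rewrite mulr_sumr.
  rewrite pair_big_dep /=; apply: eq_big => [[B t]|[B t] _] /=.
    by rewrite -!andbA.
  by rewrite big_cons.
transitivity (\sum_(U : {set 'I_n} | [&& lower U, S \subset U & odd #|U :\: S|])
    2 ^+ nb_meeting psi (U :\: S) * \sum_(t : r.-tuple {set 'I_n} | chain U t)
       \prod_(A <- t) 2 ^+ nb_meeting psi A : rat).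
  rewrite [RHS]big_mkcondr; apply: eq_big => [U|U _]; first by rewrite inE.
  by rewrite /step; case: ifP => // _; rewrite mul0r.
rewrite (reindex_onto (fun B => S :|: B) (fun U => U :\: S)) /=; last first.
  by move=> U /and3P[_ SU _]; rewrite setDE setUIr setUCr setIT; apply/setUidPr.
have DE (B : {set 'I_n}) : ((S :|: B) :\: S == B) = [disjoint S & B].
  by rewrite setDUl setDv set0U disjoint_sym; apply/eqP/setDidPl.
apply: eq_big => [B|B /andP[_ /eqP->]] //; rewrite DE subsetUl /=.
case: (boolP [disjoint S & B]) => SB; rewrite ?andbF ?andbT //.
by move: SB; rewrite -DE => /eqP->; rewrite andbC.
Qed.

End Chains.

(** * The incidence algebra of lower sets *)

(** [mulmx1C] turns the right inverse into the left inverse that [sum_odd_comp_sum_exp] expects;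
    size 0, where [1 = 0], is treated apart. *)
Lemma sum_odd_comp_sum_mx k (G G' : 'M[rat]_k) K : (0 < K)%N ->
    (2^-1 *: (G - 1)) ^+ K = 0 -> G *m G' = 1%:M ->
  \sum_(r < K) (odd_comp_sum r)%:~R *: (4^-1 *: (G - G')) ^+ r
    = 2^-1 *: (G + 1).
Proof.
case: k G G' => [|k] G G' K_gt0 GK /mulmx1C GG'; first by rewrite [LHS]flatmx0 [RHS]flatmx0.
exact: (@sum_odd_comp_sum_exp 'M[rat]_k.+1).
Qed.

Lemma exprmxZ k (a : rat) (A : 'M[rat]_k) r : (a *: A) ^+ r = a ^+ r *: A ^+ r.
Proof.
case: k A => [|k] A; first by rewrite [LHS]flatmx0 [RHS]flatmx0.
exact: exprZn.
Qed.

Section IncidenceAlgebra.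
Variables (n : nat) (phi psi : setcomp n).
Hypotheses (phi_odd : setcomp_odd phi) (psi_le : (psi <= phi)%O).
Implicit Types (S T U : {set 'I_n}).
Local Notation N := #|lower_sets phi psi|.
Local Notation ev := (@enum_val _ (mem (lower_sets phi psi))).

Definition interval_wt S T : rat :=
  if S \subset T then 2 ^+ nb_meeting psi (T :\: S) else 0.

Definition interval_mx : 'M[rat]_N := \matrix_(i, j) interval_wt (ev i) (ev j).
Definition zeta_mx : 'M[rat]_N := \matrix_(i, j) (ev i \subset ev j)%:R.
Definition sign_mx : 'M[rat]_N := diag_mx (\row_j (-1) ^+ #|ev j|).

Lemma sign_mxK : sign_mx *m sign_mx = 1%:M.
Proof.
rewrite mul_diag_mx; apply/matrixP => i j; rewrite !mxE.
by case: eqP => [->|_]; rewrite ?mulr0n ?mulr0 // mulr1n -expr2 sqrr_sign.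
Qed.

(** [zeta_mx] is unitriangular for inclusion, so the columns of [A] vanish one after another, by
    increasing size of [ev j]. *)
Lemma zeta_mx_rreg (A : 'M[rat]_N) : A *m zeta_mx = 0 -> A = 0.
Proof.
move=> AZ; apply/matrixP => i j; rewrite mxE.
have [m] := ubnP #|ev j|; elim: m j => // m IH j jm.
have := congr1 (fun B : 'M_N => B i j) AZ; rewrite !mxE (bigD1 j) //= mxE subxx mulr1.
rewrite big1 ?addr0 // => k kj; rewrite mxE.
case: (boolP (ev k \subset ev j)) => kj'; last first.
  by rewrite mulr0.
rewrite IH ?mul0r // -ltnS (leq_trans _ jm) // ltnS; apply: proper_card.
by rewrite properEneq kj' andbT (inj_eq enum_val_inj).
Qed.

Lemma interval_sign_zeta : interval_mx *m sign_mx *m zeta_mx = zeta_mx *m sign_mx.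
Proof.
rewrite !mul_mx_diag; apply/matrixP => i j; rewrite !mxE.
under eq_bigr => k _ do rewrite !mxE.
rewrite -(big_enum_val (fun U =>
  interval_wt (ev i) U * (-1) ^+ #|U| * (U \subset ev j)%:R)).
have := enum_valP i; have := enum_valP j; set S := ev i; set T := ev j.
rewrite !inE => lT lS; case: (boolP (S \subset T)) => ST; last first.
  rewrite mul0r big1 // => U _; rewrite /interval_wt.
  case: (boolP (S \subset U)) => SU; rewrite ?mul0r //.
  case: (boolP (U \subset T)) => UT; rewrite ?mulr0 //.
  by rewrite (subset_trans SU UT) in ST.
rewrite mul1r -(signed_interval_sum phi_odd psi_le lS lT ST) [RHS]big_mkcondr.
apply: eq_big => [U|U _]; first by rewrite inE.
rewrite /interval_wt; case: (S \subset U); rewrite ?mul0r //=.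
by case: (U \subset T); rewrite ?mulr1 ?mulr0.
Qed.

(** Write [G], [D], [Z] for the weight, sign and zeta matrices. Using [G D Z = Z D] twice,
    [G D G D Z = G D Z D = Z D D = Z], and [Z] cancels. *)
Lemma interval_mx_inv : interval_mx *m (sign_mx *m interval_mx *m sign_mx) = 1%:M.
Proof.
apply/subr0_eq/zeta_mx_rreg; rewrite mulmxBl mul1mx; apply/eqP; rewrite subr_eq0; apply/eqP.
rewrite -!mulmxA [interval_mx *m (sign_mx *m zeta_mx)]mulmxA interval_sign_zeta.
by rewrite !mulmxA interval_sign_zeta -mulmxA sign_mxK mulmx1.
Qed.

(** A nonzero entry strictly raises the cardinality, which can happen at most [n] times in a row. *)
Lemma interval_mx_unipotent : (2^-1 *: (interval_mx - 1)) ^+ n.+1 = 0.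
Proof.
set A := _ *: _.
have A0 i j : (#|ev j| <= #|ev i|)%N -> A i j = 0.
  move=> ji; rewrite !mxE /interval_wt; case: (eqVneq i j) => [->|ij].
    by rewrite subxx setDv nb_meeting0 subrr mulr0.
  case: (boolP (ev i \subset ev j)) => sub; last by rewrite subr0 mulr0.
  have := proper_card (B := mem (ev j)) (A := mem (ev i)).
  rewrite properEneq sub (inj_eq enum_val_inj) ij => /(_ isT).
  by rewrite ltnNge ji.
have AE k i j : (#|ev j| < #|ev i| + k)%N -> (A ^+ k) i j = 0.
  elim: k i => [|k IH] i; first by rewrite addn0 expr0 mxE; case: eqP => // ->; rewrite ltnn.
  move=> lt; rewrite exprS mxE big1 // => l _.
  case: (leqP #|ev l| #|ev i|) => li; first by rewrite A0 ?mul0r.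
  by rewrite IH ?mulr0 // (leq_trans lt) // addnS -addSn leq_add2r.
apply/matrixP => i j; rewrite AE ?mxE // addnS ltnS.
by rewrite (leq_trans (max_card _)) // card_ord leq_addl.
Qed.

(** Conjugation by the signs multiplies the entry at [S], [T] by [(-1) ^ #|T :\: S|], so the
    difference kills even intervals and doubles odd ones. *)
Lemma step_mxE :
  step_mx phi psi = 2^-1 *: (interval_mx - sign_mx *m interval_mx *m sign_mx).
Proof.
rewrite mul_mx_diag mul_diag_mx; apply/matrixP => i j; rewrite !mxE /step /interval_wt.
case: (boolP (_ \subset _)) => sub /=; last by rewrite mulr0 mul0r subrr mulr0.
rewrite -(cardsID (ev i) (ev j)) (setIidPr sub) exprD -[(-1) ^+ #|_ :\: _|]signr_odd.
rewrite mulrACA -expr2 sqrr_sign mul1r.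
case: odd; rewrite ?expr1 ?expr0 ?mulr1 ?subrr ?mulr0 //.
by move: (2 ^+ _) => c; field.
Qed.

End IncidenceAlgebra.

Theorem theorem11p5 (n : nat) (phi psi : setcomp n)
    (n_gt0 : (0 < n)%N) (phi_odd : setcomp_odd phi) (psi_le : (psi <= phi)%O) :
  \sum_(chi in setcomp_D phi psi)
    (2 : rat) ^ ((size (setcomp_meet psi chi))%:Z - (size chi)%:Z)
      * (mu_odd (size chi))%:~R
  = (2 : rat) ^ ((size psi)%:Z - 1).
Proof.
have m0 : set0 \in lower_sets phi psi by rewrite inE lower0.
have mT : setT \in lower_sets phi psi by rewrite inE lowerT.
pose i := enum_rank_in m0 set0; pose j := enum_rank_in m0 setT.
have iE : enum_val i = set0 by rewrite enum_rankK_in.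
have jE : enum_val j = setT by rewrite enum_rankK_in.
(* Here [0 < n] enters: the identity matrix in [(G + 1) / 2] then contributes nothing to this
   entry. *)
have ij : i != j.
  rewrite -(inj_eq enum_val_inj) iE jE eq_sym -cards_eq0 cardsT card_ord.
  by rewrite -lt0n.
pose w (s : seq {set 'I_n}) : rat := \prod_(B <- s) 2 ^+ nb_meeting psi B.
have two_neq0 : (2 : rat) != 0 by [].
have main := congr1 (fun A : 'M_ _ => A i j) (sum_odd_comp_sum_mx (ltn0Sn n)
  (interval_mx_unipotent phi psi) (interval_mx_inv phi_odd psi_le)).
have -> : (2 : rat) ^ ((size psi)%:Z - 1) = (2^-1 *: (interval_mx phi psi + 1)) i j.
  rewrite !mxE /interval_wt iE jE sub0set setD0 nb_meetingT (negbTE ij) addr0.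
  by rewrite expfzDr // mulrC.
rewrite -main summxE.
transitivity (\sum_(chi in setcomp_D phi psi)
    w chi * 2^-1 ^+ size chi * (odd_comp_sum (size chi))%:~R).
  apply: eq_bigr => chi _; rewrite mu_oddE expfzDr // -invr_expz -!exprnP exprVn.
  congr (_ * _ * _).
  by rewrite size_setcomp_meet /w -expr_sum.
(* Sizes are at most [n], so [inord] loses nothing and the classes match the exponents
   [r < n.+1]. *)
rewrite (partition_big (fun chi : setcomp n => inord (size chi) : 'I_n.+1) predT) //=.
apply: eq_bigr => r _; rewrite mxE.
(* One factor [2^-1] makes the odd part [step_mx]; the other, one per step, accumulates to
   [2 ^ (- size chi)]. *)
have -> : 4^-1 *: (interval_mx phi psi
    - sign_mx phi psi *m interval_mx phi psi *m sign_mx phi psi)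
   = 2^-1 *: step_mx phi psi.
  by rewrite step_mxE scalerA; congr (_ *: _).
rewrite exprmxZ mxE step_mx_exp // iE.
rewrite -(sum_setcomp_D psi_le w) !mulr_sumr.
apply: eq_big => [chi|chi /andP[_ /eqP <-]].
  by congr (_ && _); rewrite -val_eqE /= inordK // ltnS size_setcomp.
by rewrite inordK ?ltnS ?size_setcomp //; ring.
Qed.
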